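(* Let $(\mathcal{A},\circ,\alpha)$ be a Hom-Novikov superalgebra. Define the supercommutator on homogeneous elements by $$[x,y]^-=x\circ y-(-1)^{|x||y|}y\circ x .$$ Then $(\mathcal{A},[\cdot,\cdot]^-,\circ,\alpha)$ is a super Hom-Gel'fand-Dorfman bialgebra.
   Context: All linear spaces are over $\mathbb{C}$. A superspace is a $\mathbb{Z}_2$-graded linear space $\mathcal{A}=\mathcal{A}_0\oplus\mathcal{A}_1$; $|x|\in\{0,1\}$ is the parity of a homogeneous element $x$. Formulas containing $|x|$ are stated for homogeneous elements and extended by linearity. Hom-Lie superalgebra $(\mathcal{A},[\cdot,\cdot],\alpha)$: a superspace with an even bilinear map $[\cdot,\cdot]:\mathcal{A}\times\mathcal{A}\to\mathcal{A}$ and an even linear map $\alpha:\mathcal{A}\to\mathcal{A}$ such that for all homogeneous $x,y,z$: $[x,y]=-(-1)^{|x||y|}[y,x]$ and $(-1)^{|x||z|}[[x,y],\alpha(z)]+(-1)^{|x||y|}[[y,z],\alpha(x)]+(-1)^{|y||z|}[[z,x],\alpha(y)]=0$. Hom-Novikov superalgebra $(\mathcal{A},\circ,\alpha)$: a superspace with an even bilinear operation $\circ$ and an even linear map $\alpha$ such that for all homogeneous $x,y,z$: $(x\circ y)\circ\alpha(z)-\alpha(x)\circ(y\circ z)=(-1)^{|x||y|}\big((y\circ x)\circ\alpha(z)-\alpha(y)\circ(x\circ z)\big)$ and $(x\circ y)\circ\alpha(z)=(-1)^{|y||z|}(x\circ z)\circ\alpha(y)$. Super Hom-Gel'fand-Dorfman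 bialgebra $(\mathcal{A},[\cdot,\cdot],\circ,\alpha)$: a superspace with an even linear map $\alpha$ and two operations such that $(\mathcal{A},[\cdot,\cdot],\alpha)$ is a Hom-Lie superalgebra, $(\mathcal{A},\circ,\alpha)$ is a Hom-Novikov superalgebra, and for all homogeneous $x,y,z$: $[x\circ y,\alpha(z)]-(-1)^{|y||z|}[x\circ z,\alpha(y)]+[x,y]\circ\alpha(z)-(-1)^{|y||z|}[x,z]\circ\alpha(y)-\alpha(x)\circ[y,z]=0$. *)

(* Defs.v *)
From HB Require Import structures.
From mathcomp Require Import all_boot all_order all_algebra.
From mathcomp Require Import boolp classical_sets reals.
From mathcomp Require Import complex.

Set Implicit Arguments.
Unset Strict Implicit.
Unset Printing Implicit Defensive.

Import GRing.Theory.
Local Open Scope ring_scope.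

(* [homog A false] and [homog A true] are the even and odd parts A_0 and A_1;
   0 belongs to both, so "x homogeneous with |x| = i" is rendered by the
   hypothesis [homog A i x], with i quantified next to x. *)
Record superspace (K : fieldType) := Superspace {
  space :> lmodType K;
  homog : bool -> set space;
  homog0 : forall i, homog i 0;
  homog_lin : forall i (a : K) (x y : space),
    homog i x -> homog i y -> homog i (a *: x + y);
  homog_span : forall x : space,
    exists x0 x1, [/\ homog false x0, homog true x1 & x = x0 + x1];
  homog_disj : forall x : space, homog false x -> homog true x -> x = 0
}.

Section Structures.
Variables (K : fieldType) (A : superspace K).
Implicit Types (br m : A -> A -> A) (al : A -> A) (i j k : bool).

(* (-1)^{|x||y|} for |x| = i and |y| = j *)
Definition ssign i j : K := (-1) ^+ (i * j)%N.

Definition even_linear al : Prop :=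
  linear al /\ (forall i x, homog i x -> homog i (al x)).

Definition even_bilinear m : Prop :=
  [/\ forall y, linear (m ^~ y),
      forall x, linear (m x) &
      forall i j x y, homog i x -> homog j y -> homog (i (+) j) (m x y)].

Definition super_skew br : Prop :=
  forall i j (x y : A), homog i x -> homog j y ->
    br x y = - (ssign i j *: br y x).

Definition super_hom_jacobi br al : Prop :=
  forall i j k (x y z : A), homog i x -> homog j y -> homog k z ->
    ssign i k *: br (br x y) (al z) + ssign i j *: br (br y z) (al x)
      + ssign j k *: br (br z x) (al y) = 0.

Definition hom_Lie_superalgebra br al : Prop :=
  [/\ even_bilinear br, even_linear al, super_skew br
    & super_hom_jacobi br al].

Definition hom_left_symmetric m al : Prop :=
  forall i j k (x y z : A), homog i x -> homog j y -> homog k z ->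
    m (m x y) (al z) - m (al x) (m y z)
      = ssign i j *: (m (m y x) (al z) - m (al y) (m x z)).

Definition hom_right_commutative m al : Prop :=
  forall i j k (x y z : A), homog i x -> homog j y -> homog k z ->
    m (m x y) (al z) = ssign j k *: m (m x z) (al y).

Definition hom_Novikov_superalgebra m al : Prop :=
  [/\ even_bilinear m, even_linear al, hom_left_symmetric m al
    & hom_right_commutative m al].

Definition GD_compatible br m al : Prop :=
  forall i j k (x y z : A), homog i x -> homog j y -> homog k z ->
    br (m x y) (al z) - ssign j k *: br (m x z) (al y)
      + m (br x y) (al z) - ssign j k *: m (br x z) (al y)
      - m (al x) (br y z) = 0.

Definition super_hom_GD_bialgebra br m al : Prop :=
  [/\ even_linear al, hom_Lie_superalgebra br al,
      hom_Novikov_superalgebra m al & GD_compatible br m al].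

(* The component of x of parity i along A = A_0 (+) A_1. *)
Definition component i (x : A) : A :=
  xget 0 [set y | homog i y /\ homog (~~ i) (x - y)].

(* Bilinear extension of x o y - (-1)^{|x||y|} y o x from homogeneous x, y;
   see [supercommutator_homog]. *)
Definition supercommutator m : A -> A -> A := fun x y =>
  \sum_(i : bool) \sum_(j : bool)
    (m (component i x) (component j y)
       - ssign i j *: m (component j y) (component i x)).

Lemma component_eq i (x y : A) :
  homog i y -> homog (~~ i) (x - y) -> component i x = y.
Proof.
move=> hy hxy; apply: xget_unique => // z [hz hxz].
have hD l (u v : A) : homog l u -> homog l v -> homog l (u - v).
  by move=> hu hv; rewrite addrC -scaleN1r; apply: homog_lin.
have h1 : homog i (z - y) by apply: hD.
have h2 : homog (~~ i) (z - y).
  have -> : z - y = (x - y) - (x - z) by rewrite opprB [RHS]addrC addrA subrK.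
  exact: hD.
apply/eqP; rewrite -subr_eq0; apply/eqP.
by case: i hy hxy hz hxz h1 h2 => *; apply: homog_disj.
Qed.

Lemma component_homog i j (x : A) :
  homog i x -> component j x = if j == i then x else 0.
Proof.
move=> hx; case: eqP => [->|/eqP ji]; apply: component_eq => //.
- by rewrite subrr; apply: homog0.
- exact: homog0.
- by rewrite subr0; case: i j ji hx => [] [].
Qed.

Lemma supercommutator_homog m i j (x y : A) :
  (forall z, linear (m ^~ z)) -> (forall z, linear (m z)) ->
  homog i x -> homog j y ->
  supercommutator m x y = m x y - ssign i j *: m y x.
Proof.
move=> ml mr hx hy.
have m0l z : m 0 z = 0.
  by have := ml z (-1) 0 0; rewrite /= scaler0 addr0 scaleN1r addNr.
have m0r z : m z 0 = 0.
  by have := mr z (-1) 0 0; rewrite /= scaler0 addr0 scaleN1r addNr.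
rewrite /supercommutator (bigD1 i) //= (bigD1 j) //=.
rewrite (component_homog i hx) (component_homog j hy) !eqxx.
rewrite big1 => [|l lj]; last first.
  by rewrite (component_homog l hy) (negbTE lj) m0l m0r scaler0 subr0.
rewrite big1 => [|l li]; first by rewrite !addr0.
rewrite big1 // => l' _.
by rewrite (component_homog l hx) (negbTE li) m0l m0r scaler0 subr0.
Qed.

End Structures.

(* Main.v *)
(** Both identities are checked on homogeneous elements, where the
    supercommutator has its defining formula. The Hom-Jacobi identity is the
    signed cyclic sum of the left-symmetry relations. In the compatibility
    identity, right commutativity kills the terms [(x o y) o al z] and
    [(x o z) o al y]; the two left-symmetry relations for [(y, x, z)] and
    [(z, x, y)] turn what is left into right commutativity again. *)
Require Import Defs.
From mathcomp Require Import all_boot all_order all_algebra.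
From mathcomp Require Import reals complex.

Set Implicit Arguments.
Unset Strict Implicit.
Unset Printing Implicit Defensive.

Import GRing.Theory.
Local Open Scope ring_scope.

(** Decides [s = 0] for a sum [s] of opposite atoms in an additive group: the
    opposite of the leading summand is moved to the front and cancelled. *)
Ltac cancel_opposites :=
  rewrite ?opprD ?opprK ?oppr0 -?addrA ?addr0 ?add0r;
  repeat match goal with
  | |- - ?a + (?a + _) = 0 => rewrite addKr
  | |- ?a + (- ?a + _) = 0 => rewrite addNKr
  | |- - ?a + ?a = 0 => exact: addNr
  | |- ?a - ?a = 0 => exact: addrN
  | |- - ?a + _ = 0 => first [rewrite (addrCA _ a) | rewrite [_ + a]addrC]
  | |- ?a + _ = 0 => first [rewrite (addrCA _ (- a)) | rewrite [_ - a]addrC]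
  end.

Section Superspace.
Variables (K : fieldType) (A : superspace K).
Implicit Types (m : A -> A -> A) (al : A -> A) (i j k : bool) (x y z : A).

Lemma homogD i x y : homog i x -> homog i y -> homog i (x + y).
Proof. by move=> hx hy; rewrite -[x]scale1r; apply: homog_lin. Qed.

Lemma homogZ i (a : K) x : homog i x -> homog i (a *: x).
Proof. by move=> hx; rewrite -[a *: x]addr0; apply/homog_lin/homog0. Qed.

Lemma homogB i x y : homog i x -> homog i y -> homog i (x - y).
Proof. by move=> hx hy; rewrite -scaleN1r; apply/homogD/homogZ. Qed.

(** [component] is a choice with default 0; a decomposition given by [homog_span] shows that the
    default is never taken. *)
Lemma componentP i x :
  homog i (component i x) /\ homog (~~ i) (x - component i x).
Proof.
have [x0 [x1 [h0 h1 ->]]] := homog_span x.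
have e1 : x0 + x1 - x0 = x1 by rewrite addrC addKr.
by case: i; [rewrite (@component_eq _ _ _ _ x1) ?addrK
            | rewrite (@component_eq _ _ _ _ x0) ?e1].
Qed.

(** Uniqueness of the decomposition: the combination of the components passes the test of
    [component_eq]. *)
Lemma component_linear i : linear (@component K A i).
Proof.
move=> a x y; have [hx hx'] := componentP i x; have [hy hy'] := componentP i y.
apply: component_eq; first exact: homog_lin.
by rewrite opprD addrACA -scalerBr; apply: homog_lin.
Qed.

Section Bilinear.
Variable m : A -> A -> A.
Hypotheses (ml : forall y, linear (m ^~ y)) (mr : forall x, linear (m x)).

Lemma supercommutator_linearl y : linear (supercommutator m ^~ y).
Proof.
move=> a u v; rewrite /supercommutator scaler_sumr -big_split.
apply: eq_bigr => i _; rewrite scaler_sumr -big_split; apply: eq_bigr => j _ /=.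
rewrite component_linear (ml (component j y)) (mr (component j y)).
rewrite scalerBr scalerDr opprD !scalerA [ssign _ _ _ * a]mulrC.
by rewrite addrACA.
Qed.

Lemma supercommutator_linearr x : linear (supercommutator m x).
Proof.
move=> a u v; rewrite /supercommutator scaler_sumr -big_split.
apply: eq_bigr => i _; rewrite scaler_sumr -big_split; apply: eq_bigr => j _ /=.
rewrite component_linear (ml (component i x)) (mr (component i x)).
rewrite scalerBr scalerDr opprD !scalerA [ssign _ _ _ * a]mulrC.
by rewrite addrACA.
Qed.

(** The first argument has the shape of a supercommutator of homogeneous elements, with [a] as its
    sign; this opens brackets nested inside [m]. *)
Lemma bilinearBZl x y (a : K) z : m (x - a *: y) z = m x z - a *: m y z.
Proof. by rewrite addrC -scaleNr (ml z) scaleNr addrC. Qed.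

Lemma bilinearBZr x y (a : K) z : m z (x - a *: y) = m z x - a *: m z y.
Proof. by rewrite addrC -scaleNr (mr z) scaleNr addrC. Qed.

End Bilinear.

Lemma supercommutator_even_bilinear m :
  even_bilinear m -> even_bilinear (supercommutator m).
Proof.
move=> [ml mr me]; split=> [y|x|i j x y hx hy].
- exact: supercommutator_linearl.
- exact: supercommutator_linearr.
- rewrite (supercommutator_homog ml mr hx hy).
  by apply/homogB/homogZ; [|rewrite addbC]; apply: me.
Qed.

Lemma supercommutator_skew m :
  even_bilinear m -> super_skew (supercommutator m).
Proof.
move=> [ml mr _] i j x y hx hy.
rewrite (supercommutator_homog ml mr hx hy) (supercommutator_homog ml mr hy hx).
(* The sign is symmetric in the two parities and squares to 1. *)
by case: i j {hx hy} => [] []; rewrite /ssign /= ?expr0 ?expr1 ?scale1r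
  ?scaleN1r ?opprK ?opprB // addrC.
Qed.

Lemma supercommutator_jacobi m al :
  even_bilinear m -> even_linear al -> hom_left_symmetric m al ->
  super_hom_jacobi (supercommutator m) al.
Proof.
move=> [ml mr me] [_ ae] LS i j k x y z hx hy hz.
(* Left symmetry solved for [m (m u v) (al w)], to serve as a rewrite rule. *)
have ls i' j' k' u v w hu hv hw := canRL (subrK _) (LS i' j' k' u v w hu hv hw).
have brE := supercommutator_homog ml mr.
have brB i' j' k' u v w : homog i' u -> homog j' v -> homog k' w ->
    supercommutator m (supercommutator m u v) (al w) =
    m (m u v) (al w) - ssign K i' j' *: m (m v u) (al w)
    - ssign K (i' (+) j') k' *:
        (m (al w) (m u v) - ssign K i' j' *: m (al w) (m v u)).
  move=> hu hv hw; have [_ _ bre] := supercommutator_even_bilinear (And3 ml mr me).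
  rewrite (brE _ _ _ _ (bre _ _ _ _ hu hv) (ae _ _ hw)) (brE _ _ _ _ hu hv).
  by rewrite bilinearBZl // bilinearBZr.
rewrite (brB i j k) // (brB j k i) // (brB k i j) //.
(* Only the products in cyclic order are rewritten; the copies of [m (m y x) (al z)] and its cyclic
   shifts that arise cancel those already present. *)
rewrite (ls _ _ _ _ _ _ hx hy hz) (ls _ _ _ _ _ _ hy hz hx).
rewrite (ls _ _ _ _ _ _ hz hx hy) {ls brE brB LS}.
(* Once the parities are fixed every sign is 1 or -1, and a sum of opposite terms remains. *)
by case: i j k {hx hy hz} => [] [] []; rewrite /ssign /= ?expr0 ?expr1 ?scale1r
  ?scaleN1r; cancel_opposites.
Qed.

Lemma supercommutator_compatible m al :
  hom_Novikov_superalgebra m al -> GD_compatible (supercommutator m) m al.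
Proof.
move=> [[ml mr me] [_ ae] LS RC] i j k x y z hx hy hz.
have ls i' j' k' u v w hu hv hw := canRL (subrK _) (LS i' j' k' u v w hu hv hw).
have brE := supercommutator_homog ml mr.
rewrite (brE _ _ _ _ (me _ _ _ _ hx hy) (ae _ _ hz)).
rewrite (brE _ _ _ _ (me _ _ _ _ hx hz) (ae _ _ hy)).
rewrite (brE _ _ _ _ hx hy) (brE _ _ _ _ hx hz) (brE _ _ _ _ hy hz).
rewrite !(bilinearBZl ml) !(bilinearBZr mr).
rewrite (ls _ _ _ _ _ _ hy hx hz) (ls _ _ _ _ _ _ hz hx hy).
(* Left symmetry has just produced new copies of [m (m x y) (al z)], so this single rewrite covers
   both uses of right commutativity. *)
rewrite (RC _ _ _ _ _ _ hx hy hz) {ls brE LS RC}.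
by case: i j k {hx hy hz} => [] [] []; rewrite /ssign /= ?expr0 ?expr1 ?scale1r
  ?scaleN1r; cancel_opposites.
Qed.

End Superspace.

Theorem theorem3p2 (R : realType) (A : superspace (complex R))
    (m : A -> A -> A) (al : A -> A) :
  hom_Novikov_superalgebra m al ->
  super_hom_GD_bialgebra (supercommutator m) m al.
Proof.
move=> N; have [mb ae ls _] := N; split=> //.
- split=> //; first exact: supercommutator_even_bilinear.
  + exact: supercommutator_skew.
  + exact: supercommutator_jacobi.
- exact: supercommutator_compatible.
Qed.
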